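(* Let $G=(V_1,E_1)$ be a connected graph with $|V_1|\ge 2$, and let $H=(V_2,E_2)$ be a $\kappa$-regular graph on $n=|V_2|\ge1$ vertices ($\kappa\ge0$) with adjacency matrix $A_H$. Put $\gamma_3=-2-\min\mathrm{ev}(A_H)$. Then $\mathrm{QEC}(G\odot H)=-2-\min\mathrm{ev}(A_H)$ if one of the following holds: (i) $\mathrm{QEC}(G)\le\dfrac{\gamma_3^2+\gamma_3(\kappa+2)}{\gamma_3(n+1)+\kappa+2}$ and $\gamma_3<0$; (ii) $\mathrm{QEC}(G)\le0$ and $\gamma_3>0$; (iii) $0<\mathrm{QEC}(G)\le\dfrac{\gamma_3^2+\gamma_3(\kappa+2)}{\gamma_3(n+1)+\kappa+2}$ and $\gamma_3>0$.
   Context: All graphs are finite, simple, undirected. The corona graph $G\odot H$ is obtained by taking one copy of $G$ and $|V_1|$ disjoint copies of $H$, and joining the $i$-th vertex of $G$ to every vertex of the $i$-th copy of $H$. For a connected graph $X$ with distance matrix $D_X$, $\mathrm{QEC}(X)=\max\{\langle f,D_Xf\rangle : \langle f,f\rangle=1,\ \langle\mathbf 1,f\rangle=0\}$, $\mathbf 1$ the all-ones vector. $\mathrm{ev}(A)$ is the set of eigenvalues of $A$.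
   Formalization: Case (i) additionally assumes that the denominator γ3(n+1)+κ+2 is positive; without this it is false (G=K_2, H=K_1: the corona is P_4, whose QEC is at least -1, not -2) or the fraction is undefined (H=K_n, n≥2). *)

(* Defs.v *)
From mathcomp Require Import all_boot all_order all_algebra.
From mathcomp Require Import boolp classical_sets reals.

Set Implicit Arguments.
Unset Strict Implicit.
Unset Printing Implicit Defensive.

Import Order.TTheory GRing.Theory Num.Theory.

Record sgraph := SGraph {
  vertex :> finType;
  adj : rel vertex;
  adj_sym : symmetric adj;
  adj_irr : irreflexive adj }.

Definition connected_graph (X : sgraph) : Prop :=
  forall x y : X, connect (@adj X) x y.

Definition regular_graph (X : sgraph) (k : nat) : Prop :=
  forall x : X, #|[pred y : X | adj x y]| = k.

Definition has_walk (X : sgraph) (x y : X) (d : nat) : bool :=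
  [exists p : d.-tuple X, path (@adj X) x p && (last x p == y)].

(* The least length of a walk from x to y.  If x and y are connected, this
   length is less than #|X|; otherwise gdist x y takes the junk value #|X|. *)
Definition gdist (X : sgraph) (x y : X) : nat :=
  find (has_walk x y) (iota 0 #|X|).

(* inl i is the vertex i of G, and inr (i, x) is the vertex x of the copy of H
   attached to i. *)
Definition corona_adj (G H : sgraph) : rel (G + G * H)%type :=
  fun u v =>
    match u, v with
    | inl i, inl j => adj i j
    | inl i, inr (j, _) => i == j
    | inr (i, _), inl j => i == j
    | inr (i, x), inr (j, y) => (i == j) && adj x y
    end.

Lemma corona_adj_sym (G H : sgraph) : symmetric (@corona_adj G H).
Proof.
by move=> [i|[i x]] [j|[j y]] //=; rewrite 1?eq_sym // adj_sym.
Qed.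

Lemma corona_adj_irr (G H : sgraph) : irreflexive (@corona_adj G H).
Proof. by move=> [i|[i x]] /=; rewrite adj_irr ?andbF. Qed.

Definition corona (G H : sgraph) : sgraph :=
  SGraph (@corona_adj_sym G H) (@corona_adj_irr G H).

Local Open Scope classical_set_scope.
Local Open Scope ring_scope.

(* The greatest and the least element of S, with junk value 0 if there is
   none. *)
Definition set_max (R : realType) (S : set R) : R :=
  xget 0 [set m | S m /\ ubound S m].

Definition set_min (R : realType) (S : set R) : R :=
  xget 0 [set m | S m /\ lbound S m].

Definition adjacency_mx (R : realType) (X : sgraph) : 'M[R]_#|X| :=
  \matrix_(i, j) (adj (enum_val i) (enum_val j))%:R.

Definition distance_mx (R : realType) (X : sgraph) : 'M[R]_#|X| :=
  \matrix_(i, j) (gdist (enum_val i) (enum_val j))%:R.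

Definition inner (R : realType) (m : nat) (u v : 'cV[R]_m) : R :=
  \sum_i u i 0 * v i 0.

Definition QEC (R : realType) (X : sgraph) : R :=
  set_max [set inner f (distance_mx R X *m f) | f in
             [set f : 'cV[R]_#|X| | inner f f = 1 /\ inner (const_mx 1) f = 0]].

Definition ev (R : realType) (m : nat) (A : 'M[R]_m) : set R :=
  [set a | eigenvalue A a].

(* Main.v *)
Require Import Defs.
From mathcomp Require Import all_boot all_order all_algebra.
From mathcomp Require Import boolp classical_sets reals.
From mathcomp Require Import topology normedtype derive.
From mathcomp Require Import ring lra.

Set Implicit Arguments.
Unset Strict Implicit.
Unset Printing Implicit Defensive.

Import Order.TTheory GRing.Theory Num.Theory.
Import numFieldNormedType.Exports.

(* For f on the corona, let h_i be its restriction to the i-th copy of H, s_i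
   the sum of the entries of h_i, and t_i = f_i + s_i the total weight of f on
   vertex i and its copy.  If t sums to 0, then
     <f, D f> = <t, D_G t> - \sum_i <h_i, (2 + A_H) h_i>.
   Write g for gamma3 and b = (kappa - min ev A_H) / n, so that
   g + b = den / n > 0 and num / den = g b / (g + b).  Since H is regular, the
   Rayleigh bound on the component of h_i orthogonal to the all-ones vector
   yields <h_i, (2 + A_H) h_i> + g |h_i|^2 >= b s_i^2.  On the other hand
   <t, D_G t> <= QEC(G) |t|^2 <= g b / (g + b) \sum_i t_i^2, which is at most
   \sum_i (g (t_i - s_i)^2 + b s_i^2); as t_i - s_i = f_i, this gives
   <f, D f> <= g |f|^2.  Equality holds for an eigenvector of A_H for the least
   eigenvalue, placed on a single copy: it is orthogonal to the all-ones vector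
   because den > 0 forces min ev A_H <> kappa. *)

(** * Walks and graph distance *)

Lemma has_walkP (X : sgraph) (x y : X) (d : nat) :
  reflect (exists p, [/\ path (@adj X) x p, last x p = y & size p = d])
    (has_walk x y d).
Proof.
apply: (iffP existsP) => [[p /andP[xp /eqP py]]|[p [xp py /eqP sp]]].
  by exists p; split=> //; rewrite size_tuple.
by exists (Tuple sp); rewrite /= xp py eqxx.
Qed.

Lemma has_walk_connect (X : sgraph) (x y : X) (d : nat) :
  has_walk x y d -> connect (@adj X) x y.
Proof. by case/has_walkP=> p [xp py _]; apply/connectP; exists p. Qed.

Lemma has_walk_cat (X : sgraph) (x y z : X) (d e : nat) :
  has_walk x y d -> has_walk y z e -> has_walk x z (d + e).
Proof.
case/has_walkP=> p [xp py <-] /has_walkP[q [yq qz <-]].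
by apply/has_walkP; exists (p ++ q); rewrite cat_path last_cat py xp size_cat.
Qed.

Lemma has_walk0 (X : sgraph) (x : X) : has_walk x x 0.
Proof. by apply/has_walkP; exists [::]. Qed.

Lemma has_walk1 (X : sgraph) (x y : X) : adj x y -> has_walk x y 1.
Proof. by move=> xy; apply/has_walkP; exists [:: y]; rewrite /= xy. Qed.

Lemma gdist_leq (X : sgraph) (x y : X) (d : nat) :
  has_walk x y d -> gdist x y <= d.
Proof.
move=> xyd; have [dX|Xd] := ltnP d #|X|.
  rewrite leqNgt; apply/negP => /(before_find 0).
  by rewrite nth_iota // add0n xyd.
by apply: leq_trans (find_size _ _) _; rewrite size_iota.
Qed.

(** A duplicate-free path has fewer than [#|X|] steps, so the bounded search in [gdist] succeeds. *)
Lemma has_walk_gdist (X : sgraph) (x y : X) :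
  connect (@adj X) x y -> has_walk x y (gdist x y).
Proof.
case/connectP=> p xp ->; case/shortenP: xp => {}p xp up _.
have sp : size p < #|X|.
  by rewrite -[_.+1]/(size (x :: p)) -(card_uniqP up) max_card.
have hX : has (has_walk x (last x p)) (iota 0 #|X|).
  apply/hasP; exists (size p); first by rewrite mem_iota.
  by apply/has_walkP; exists p.
have := nth_find 0 hX; rewrite nth_iota //.
by rewrite -[X in _ < X](size_iota 0) -has_find.
Qed.

(* A length realized by a walk, and which grows by at most one along an edge,
   is the distance. *)
Lemma gdist_unique (X : sgraph) (D : X -> X -> nat) :
    (forall x y, has_walk x y (D x y)) -> (forall x, D x x = 0) ->
    (forall x y z, adj y z -> D x z <= (D x y).+1) ->
  forall x y, gdist x y = D x y.
Proof.
move=> walkD D0 lipD x y; apply/eqP; rewrite eqn_leq gdist_leq //=.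
have /has_walkP[p [xp <- <-]] := has_walk_gdist (has_walk_connect (walkD x y)).
elim/last_ind: p xp => [|p z IHp]; first by rewrite D0.
rewrite rcons_path last_rcons size_rcons => /andP[/IHp xp pz].
exact: leq_trans (lipD _ _ _ pz) _.
Qed.

Lemma gdist0 (X : sgraph) (x : X) : gdist x x = 0.
Proof. by apply/eqP; rewrite -leqn0 gdist_leq ?has_walk0. Qed.

Lemma gdist_adj (X : sgraph) (x y z : X) :
  connect (@adj X) x y -> adj y z -> gdist x z <= (gdist x y).+1.
Proof.
move=> xy yz; rewrite -addn1; apply: gdist_leq.
exact: has_walk_cat (has_walk_gdist xy) (has_walk1 yz).
Qed.

(** * Distances in the corona *)

Definition corona_dist (G H : sgraph) (u v : corona G H) : nat :=
  match u, v with
  | inl i, inl j => gdist i j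
  | inl i, inr (j, _) => (gdist i j).+1
  | inr (i, _), inl j => (gdist i j).+1
  | inr (i, x), inr (j, y) =>
      if i == j then (x != y) * (2 - adj x y) else (gdist i j).+2
  end.

(** Distinct copies communicate only through their base vertices; inside a copy, the detour through
    the base vertex caps the distance at 2. *)
Lemma gdist_corona (G H : sgraph) : connected_graph G ->
  forall u v : corona G H, gdist u v = corona_dist u v.
Proof.
move=> cG; apply: gdist_unique; last first.
- case=> [i|[i x]] [j|[j y]] [k|[k z]] //=.
  + exact: gdist_adj.
  + by move/eqP->.
  + by move/eqP->; rewrite ltnW.
  + by case/andP=> /eqP->.
  + by move=> jk; rewrite ltnS gdist_adj.
  + by move/eqP->; case: eqP => // _; case: (x != z); case: adj.
  + by move/eqP->; case: eqP => [->|_]; rewrite ?gdist0 // -addn2 leq_addr.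
  + case/andP=> /eqP-> yz; case: eqP => // _.
    have [->|xy] := eqVneq x y; first by rewrite yz; case: (y != z).
    by case: (x != z) (adj x z) (adj x y) => [] [] [].
- by case=> [i|[i x]] /=; rewrite ?gdist0 ?eqxx.
have walkG i j : has_walk (inl i : corona G H) (inl j) (gdist i j).
  have /has_walkP[p [ip <- <-]] := has_walk_gdist (cG i j).
  apply/has_walkP; exists (map inl p).
  by split; rewrite ?path_map ?last_map ?size_map.
have up i x : has_walk (inl i : corona G H) (inr (i, x)) 1.
  by apply: has_walk1; rewrite /= eqxx.
have down i x : has_walk (inr (i, x) : corona G H) (inl i) 1.
  by apply: has_walk1; rewrite /= eqxx.
case=> [i|[i x]] [j|[j y]] //=.
- by rewrite -addn1; apply: has_walk_cat (walkG i j) (up j y).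
- by rewrite -add1n; apply: has_walk_cat (down i x) (walkG i j).
case: eqP => [->|_]; last first.
  rewrite -addn1 -[X in X + 1]add1n.
  exact: has_walk_cat (has_walk_cat (down i x) (walkG i j)) (up j y).
have [->|_] := eqVneq x y; first exact: has_walk0.
have [xy|_] := boolP (adj x y); last exact: has_walk_cat (down j x) (up j y).
by apply: has_walk1; rewrite /= eqxx.
Qed.

Local Open Scope classical_set_scope.
Local Open Scope ring_scope.

(** * Inner products and quadratic forms on the unit sphere *)

Section Inner.
Variables (R : realType) (n : nat).
Implicit Types (u v w f : 'cV[R]_n) (M : 'M[R]_n).

Lemma innerC u v : inner u v = inner v u.
Proof. by apply: eq_bigr => i _; rewrite mulrC. Qed.

Lemma innerDl u v w : inner (u + v) w = inner u w + inner v w.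
Proof. by rewrite -big_split; apply: eq_bigr => i _; rewrite !mxE mulrDl. Qed.

Lemma innerDr u v w : inner w (u + v) = inner w u + inner w v.
Proof. by rewrite !(innerC w) innerDl. Qed.

Lemma innerZl a u v : inner (a *: u) v = a * inner u v.
Proof.
by rewrite /inner big_distrr; apply: eq_bigr => i _; rewrite !mxE /= mulrA.
Qed.

Lemma innerZr a u v : inner u (a *: v) = a * inner u v.
Proof. by rewrite !(innerC u) innerZl. Qed.

Lemma inner_ge0 u : 0 <= inner u u.
Proof. by apply: sumr_ge0 => i _; rewrite -expr2 sqr_ge0. Qed.

Lemma inner_eq0 u : (inner u u == 0) = (u == 0).
Proof.
apply/eqP/eqP => [u0|->]; last by apply: big1 => i _; rewrite mxE mul0r.
apply/matrixP => i j; rewrite ord1 mxE; apply/eqP.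
rewrite -sqrf_eq0 expr2; apply/eqP/(psumr_eq0P _ u0) => // k _.
by rewrite -expr2 sqr_ge0.
Qed.

Lemma inner_mulmxr M u v : inner u (M *m v) = inner (M^T *m u) v.
Proof.
rewrite /inner; under eq_bigr do rewrite mxE big_distrr.
rewrite exchange_big; apply: eq_bigr => i _ /=.
by rewrite mxE big_distrl; apply: eq_bigr => j _; rewrite !mxE /= mulrCA mulrA.
Qed.

Lemma inner_normalize u :
  u != 0 -> exists2 a, 0 < a & inner (a *: u) (a *: u) = 1.
Proof.
rewrite -inner_eq0 => u0; exists (Num.sqrt (inner u u))^-1.
  by rewrite invr_gt0 sqrtr_gt0 lt_def u0 inner_ge0.
rewrite innerZl innerZr mulrA -expr2 exprVn sqr_sqrtr ?inner_ge0 //.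
by rewrite mulVf.
Qed.

(** Both sides are homogeneous of degree 2 in [f], so unit vectors suffice. *)
Lemma quadratic_form_le M w (c : R) :
    (forall f, inner f f = 1 -> inner w f = 0 -> inner f (M *m f) <= c) ->
  forall f, inner w f = 0 -> inner f (M *m f) <= c * inner f f.
Proof.
move=> Mc f wf; have [->|f0] := eqVneq f 0.
  by rewrite mulmx0 (eqP (etrans (inner_eq0 0) (eqxx _))) mulr0.
have [a a0 af1] := inner_normalize f0.
have: inner (a *: f) (M *m (a *: f)) <= c * inner (a *: f) (a *: f).
  by rewrite af1 mulr1 Mc // innerZr wf mulr0.
by rewrite -scalemxAr !innerZl !innerZr !(mulrCA c) !ler_pM2l.
Qed.

(** The unit sphere cut by the hyperplane orthogonal to [w] is compact; [w = 0] gives the whole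
    sphere. *)
Lemma quadratic_form_max M w :
    (exists2 f, inner f f = 1 & inner w f = 0) ->
  exists f, [/\ inner f f = 1, inner w f = 0 &
    forall g, inner g g = 1 -> inner w g = 0 ->
      inner g (M *m g) <= inner f (M *m f)].
Proof.
(* Columns are handled through their transposes, as closed bounded sets are only
   known to be compact for row vectors. *)
pose ctr (F : 'cV[R]_n -> R) := continuous (fun x : 'rV[R]_n => F x^T).
have ctr_sum I (F : I -> 'cV[R]_n -> R) r :
    (forall i, ctr (F i)) -> ctr (fun f => \sum_(i <- r) F i f).
  move=> cF; apply: continuous_big => [|i _]; last exact: cF.
  exact: add_continuous.
have ctr_coord i : ctr (fun f => f i 0).
  rewrite /ctr (_ : (fun x : 'rV_n => x^T i 0) = fun x => x 0 i).
    exact: coord_continuous.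
  by apply/funext => x; rewrite mxE.
have ctr_inner (F G : 'cV[R]_n -> 'cV[R]_n) :
    (forall i, ctr (fun f => F f i 0)) -> (forall i, ctr (fun f => G f i 0)) ->
    ctr (fun f => inner (F f) (G f)).
  move=> cF cG; apply: ctr_sum => i x; exact: cvgM (cF i x) (cG i x).
have cM : ctr (fun f => inner f (M *m f)).
  apply: ctr_inner => // i.
  rewrite /ctr (_ : (fun x => _) = fun x : 'rV_n => \sum_j M i j * x^T j 0).
    apply: (ctr_sum _ (fun j f => M i j * f j 0)) => j x.
    exact: cvgM (cvg_cst (M i j)) (ctr_coord j x).
  by apply/funext => x; rewrite mxE.
move=> [f0 f01 wf0].
pose K := [set x : 'rV[R]_n | inner x^T x^T = 1 /\ inner w x^T = 0].
have cK : compact K.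
  apply: bounded_closed_compact; last first.
    have closed_fiber F c : ctr F -> closed [set x : 'rV_n | F x^T = c].
      move=> cF; apply: (@preimage_closed _ R (fun x : 'rV_n => F x^T) [set c]);
        last exact: closed_eq.
      by move=> x _; exact: cF.
    apply: closedI.
      apply: (closed_fiber (fun f => inner f f)).
      exact: (ctr_inner id id).
    apply: (closed_fiber (fun f => inner w f)).
    apply: (ctr_inner (fun=> w) id) => // i.
    exact: (@cst_continuous _ R (w i 0)).
  (* The norm is the maximum norm, and each squared entry is at most the sum of all squares, which
     is 1. *)
  exists 1; split; first exact: real1.
  move=> M1 M1gt1 x [x1 _]; apply: le_trans (ltW M1gt1).
  rewrite [leLHS]/Num.Def.normr /= mx_normrE.
  apply/bigmax_leP; split=> //= -[i j] _ /=.
  rewrite ord1 -(@expr_le1 _ 2) // real_normK ?num_real //.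
  rewrite -x1 /inner (bigD1 j) //= !mxE -expr2 lerDl sumr_ge0 // => k _.
  by rewrite -expr2 sqr_ge0.
have K0 : K !=set0 by exists f0^T; rewrite /K /= trmxK.
have [x xK xmax] := compact_EVT_max K0 cK (continuous_subspaceT cM).
move: xK; rewrite inE => -[x1 wx]; exists x^T; split=> // g g1 wg.
by have := xmax g^T; rewrite trmxK; apply; rewrite inE /K /= trmxK.
Qed.

End Inner.

(** * Least eigenvalue and QEC as attained extrema *)

Lemma set_max_eq (R : realType) (S : set R) m :
  S m -> ubound S m -> set_max S = m.
Proof.
move=> Sm ubm; rewrite /set_max.
case: xgetP => [_ -> [Sx ubx]|/(_ m)[]//].
by apply/eqP; rewrite eq_le ubm ?ubx.
Qed.

Lemma set_min_eq (R : realType) (S : set R) m :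
  S m -> lbound S m -> set_min S = m.
Proof.
move=> Sm lbm; rewrite /set_min.
case: xgetP => [_ -> [Sx lbx]|/(_ m)[]//].
by apply/eqP; rewrite eq_le lbm ?lbx.
Qed.

(** A minimizer of the Rayleigh quotient is an eigenvector, and each eigenvalue is the quotient at
    its own eigenvector, hence no smaller. *)
Lemma min_ev_sym (R : realType) (n : nat) (A : 'M[R]_n) :
    (0 < n)%N -> A^T = A ->
  exists v, [/\ inner v v = 1, A *m v = set_min (ev A) *: v &
    forall h, set_min (ev A) * inner h h <= inner h (A *m h)].
Proof.
case: n A => // n A _ symA.
have inner0 (f : 'cV[R]_n.+1) : inner 0 f = 0.
  by apply: big1 => i _; rewrite mxE mul0r.
have [|v [v1 _ vmax]] := @quadratic_form_max R n.+1 (- A) 0.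
  have e0 : delta_mx 0 0 != 0 :> 'cV[R]_n.+1.
    by apply/eqP => /matrixP/(_ 0 0)/eqP; rewrite !mxE oner_eq0.
  by have [a _ ae1] := inner_normalize e0; exists (a *: delta_mx 0 0).
set l := inner v (A *m v).
have innerNr (f g : 'cV[R]_n.+1) : inner f (- g) = - inner f g.
  by rewrite -scaleN1r innerZr mulN1r.
have rayleigh h : l * inner h h <= inner h (A *m h).
  rewrite -lerN2 -mulNr -innerNr -mulNmx.
  apply: (@quadratic_form_le _ _ _ 0); last exact: inner0.
  move=> f f1 _.
  by apply: le_trans (vmax f f1 (inner0 f)) _; rewrite mulNmx innerNr.
have Av : A *m v = l *: v.
  (* Were u nonzero, moving v along - u would lower the Rayleigh quotient. *)
  apply/eqP; rewrite -subr_eq0; set u := _ - _.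
  have uE : inner u u = inner u (A *m v) - l * inner u v.
    by rewrite {2}/u innerDr innerNr innerZr.
  rewrite -inner_eq0; clearbody u.
  set s := inner u u; set c := inner u (A *m u) - l * s.
  have c0 : 0 <= c by rewrite subr_ge0; exact: rayleigh.
  have s0 : 0 <= s := inner_ge0 u.
  have quad e : 0 <= e *+ 2 * s + e ^+ 2 * c.
    have := rayleigh (v + e *: u); rewrite -subr_ge0; congr (_ <= _).
    rewrite mulmxDr -scalemxAr !(innerDl, innerDr, innerZl, innerZr) v1.
    have -> : inner v (A *m u) = inner u (A *m v).
      by rewrite inner_mulmxr symA innerC.
    rewrite (innerC v u) -/l -/s {2}/s uE /c; ring.
  rewrite eq_le s0 andbT leNgt; apply/negP => sp.
  have cs : 0 < c + s by rewrite ltr_wpDl.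
  (* The vertex [- (s / c)] of the parabola is undefined for [c = 0]; adding [s] to the denominator
     repairs this and keeps the value negative. *)
  have := quad (- (s / (c + s))); rewrite leNgt => /negP; apply.
  have -> : - (s / (c + s)) *+ 2 * s + (- (s / (c + s))) ^+ 2 * c =
      - (s ^+ 2 / (c + s) ^+ 2 * (c + s *+ 2)).
    by field; rewrite gt_eqF.
  by rewrite oppr_lt0 mulr_gt0 ?divr_gt0 ?exprn_gt0 // ltr_wpDl ?mulrn_wgt0.
suff -> : set_min (ev A) = l by exists v.
apply: set_min_eq.
  (* [eigenvalue] concerns row vectors; symmetry of [A] allows transposing. *)
  apply/eigenvalueP; exists v^T; first by rewrite -{1}symA -trmx_mul Av linearZ.
  by rewrite -trmx0 (inj_eq trmx_inj) -inner_eq0 v1 oner_eq0.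
move=> a /eigenvalueP[w wA w0].
have Aw : A *m w^T = a *: w^T by rewrite -{1}symA -trmx_mul wA linearZ.
have := rayleigh w^T; rewrite Aw innerZr ler_pM2r //.
by rewrite lt_def inner_ge0 inner_eq0 -trmx0 (inj_eq trmx_inj) w0.
Qed.

(** The maximum is attained, so [QEC] is not the default value of [set_max], and the bound extends
    by homogeneity. *)
Lemma QEC_ge (R : realType) (X : sgraph) (f : 'cV[R]_#|X|) :
  inner (const_mx 1) f = 0 ->
  inner f (distance_mx R X *m f) <= QEC R X * inner f f.
Proof.
apply: quadratic_form_le => {}f f1 f0.
have [|g [g1 g0 gmax]] :=
  @quadratic_form_max _ _ (distance_mx R X) (const_mx 1).
  by exists f.
suff -> : QEC R X = inner g (distance_mx R X *m g) by exact: gmax.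
apply: set_max_eq; first by exists g.
by move=> _ [h [h1 h0] <-]; exact: gmax.
Qed.

(** * Column vectors as functions on a finite type *)

Section Vec.
Variable R : realType.

Definition vec (X : finType) (F : X -> R) : 'cV[R]_#|X| :=
  \col_i F (enum_val i).

Lemma vecE (X : finType) (f : 'cV[R]_#|X|) :
  f = vec (fun u => f (enum_rank u) 0).
Proof. by apply/matrixP => i j; rewrite mxE enum_valK ord1. Qed.

Lemma inner_vec (X : finType) (F F' : X -> R) :
  inner (vec F) (vec F') = \sum_u F u * F' u.
Proof.
rewrite [RHS](reindex_onto _ _ (fun u _ => enum_rankK u)) /=.
by apply: eq_big => i; rewrite ?enum_valK ?eqxx ?mxE.
Qed.

Lemma mulmx_vec (X : finType) (M : X -> X -> R) (F : X -> R) :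
  (\matrix_(i, j) M (enum_val i) (enum_val j)) *m vec F =
  vec (fun u => \sum_v M u v * F v).
Proof.
apply/matrixP => i j; rewrite !mxE.
rewrite [RHS](reindex_onto _ _ (fun u _ => enum_rankK u)) /=.
by apply: eq_big => k; rewrite ?enum_valK ?eqxx // !mxE.
Qed.

Lemma const_vec (X : finType) a : const_mx a = vec (fun _ : X => a).
Proof. by apply/matrixP => i j; rewrite !mxE. Qed.

End Vec.

(** * Adjacency spectrum of a regular graph *)

Section Regular.
Variables (R : realType) (H : sgraph) (kappa n : nat).
Hypotheses (H_card : #|H| = n) (n_ge1 : (1 <= n)%N).
Hypothesis H_regular : regular_graph H kappa.

Let A := adjacency_mx R H.
Let lam := set_min (ev A).

Lemma trmx_adjacency : A^T = A.
Proof. by apply/matrixP => i j; rewrite !mxE adj_sym. Qed.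

Lemma adjacency_vec F :
  A *m vec F = vec (fun x => \sum_y (adj x y)%:R * F y).
Proof. exact: (mulmx_vec (fun x y => (adj x y)%:R)). Qed.

Lemma adjacency_const1 : A *m const_mx 1 = kappa%:R *: const_mx 1 :> 'cV_#|H|.
Proof.
rewrite const_vec adjacency_vec; apply/matrixP => i j; rewrite !mxE mulr1.
rewrite -(H_regular (enum_val i)) -sum1_card natr_sum [RHS]big_mkcond /=.
by apply: eq_bigr => y _; rewrite mulr1 inE; case: adj.
Qed.

Lemma inner_const1_adjacency k :
  inner (const_mx 1) (A *m k) = kappa%:R * inner (const_mx 1) k.
Proof. by rewrite inner_mulmxr trmx_adjacency adjacency_const1 innerZl. Qed.

Lemma inner_const1 : inner (const_mx 1) (const_mx 1 : 'cV[R]_#|H|) = n%:R.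
Proof.
rewrite /inner; under eq_bigr do rewrite !mxE mulr1.
by rewrite sumr_const card_ord H_card.
Qed.

(** The Rayleigh bound is applied to [k] minus its mean; by regularity the constant part is an
    eigenvector for [kappa]. *)
Lemma regular_rayleigh k :
  (kappa%:R - lam) * inner (const_mx 1) k ^+ 2 / n%:R <=
  inner k (A *m k) - lam * inner k k.
Proof.
have [|v [_ _ ray]] := @min_ev_sym R _ A _ trmx_adjacency.
  by rewrite H_card.
have n0 : n%:R != 0 :> R by rewrite pnatr_eq0 -lt0n.
set s := inner (const_mx 1) k.
rewrite -subr_ge0; have := ray (k + (- (s / n%:R)) *: const_mx 1).
rewrite -/lam -subr_ge0.
rewrite mulmxDr -scalemxAr !(innerDl, innerDr, innerZl, innerZr).
rewrite inner_const1_adjacency adjacency_const1 !innerZr inner_const1.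
rewrite (innerC k (const_mx 1)) -/s.
by congr (_ <= _); field.
Qed.

(** Eigenvectors of a symmetric matrix for distinct eigenvalues, here [lam] and [kappa], are
    orthogonal. *)
Lemma min_eigenvector_orthogonal : lam != kappa%:R ->
  exists v,
    [/\ inner v v = 1, inner (const_mx 1) v = 0 & inner v (A *m v) = lam].
Proof.
move=> lk; have [|v [v1 Av _]] := @min_ev_sym R _ A _ trmx_adjacency.
  by rewrite H_card.
exists v; split=> //; last by rewrite Av innerZr v1 mulr1.
apply/eqP; have /eqP := inner_const1_adjacency v.
by rewrite Av innerZr -subr_eq0 -mulrBl mulf_eq0 subr_eq0 (negbTE lk).
Qed.

End Regular.

(** * The distance form of the corona *)

Section Corona.
Variables (R : realType) (G H : sgraph).
Hypothesis G_connected : connected_graph G.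
Variable f : corona G H -> R.

Definition copy i : 'cV[R]_#|H| := vec (fun x => f (inr (i, x))).
Definition weight i : R := f (inl i) + inner (const_mx 1) (copy i).

Lemma inner_const1_copy i : inner (const_mx 1) (copy i) = \sum_x f (inr (i, x)).
Proof.
by rewrite const_vec inner_vec; apply: eq_bigr => x _; rewrite mul1r.
Qed.

Lemma sum_corona (F : corona G H -> R) :
  \sum_u F u = \sum_i (F (inl i) + \sum_x F (inr (i, x))).
Proof.
rewrite big_sumType big_split pair_bigA /=; congr (_ + _).
by apply: eq_bigr => -[].
Qed.

Lemma inner_corona_const1 :
  inner (const_mx 1) (vec f) = \sum_i weight i.
Proof.
rewrite const_vec inner_vec sum_corona; apply: eq_bigr => i _.
by rewrite /weight inner_const1_copy mul1r; under eq_bigr do rewrite mul1r.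
Qed.

Lemma inner_corona :
  inner (vec f) (vec f) = \sum_i (f (inl i) ^+ 2 + inner (copy i) (copy i)).
Proof.
by rewrite inner_vec sum_corona; apply: eq_bigr => i _; rewrite inner_vec expr2.
Qed.

Lemma distance_vec (X : sgraph) F :
  distance_mx R X *m vec F = vec (fun x => \sum_y (gdist x y)%:R * F y).
Proof. exact: (mulmx_vec (fun x y => (gdist x y)%:R)). Qed.

(** Isolates the matrix [2 + A_H] as the correction on diagonal blocks. *)
Lemma gdist_corona_copies i j x y :
  (gdist (inr (i, x) : corona G H) (inr (j, y)))%:R =
  (gdist i j)%:R + 2 -
    (if i == j then 2 * (x == y)%:R + (adj x y)%:R else 0) :> R.
Proof.
rewrite gdist_corona //=; have [->|_] := eqVneq i j; last first.
  by rewrite subr0 -addn2 natrD.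
rewrite gdist0; have [->|_] := eqVneq x y.
  by rewrite adj_irr mul0n /=; ring.
by case: adj; rewrite mul1n ?subn1 ?subn0 /=; ring.
Qed.

(** Up to the diagonal blocks, a distance is that of the base vertices plus 1 for each endpoint
    lying in a copy; these extra units multiply the total weight, which is 0. *)
Lemma corona_form :
    \sum_i weight i = 0 ->
  inner (vec f) (distance_mx R (corona G H) *m vec f) =
  inner (vec weight) (distance_mx R G *m vec weight) -
  \sum_i (2 * inner (copy i) (copy i) +
          inner (copy i) (adjacency_mx R H *m copy i)).
Proof.
move=> w0; rewrite !distance_vec !inner_vec.
pose p i : R := \sum_j (gdist i j)%:R * weight j.
pose S : R := \sum_i inner (const_mx 1) (copy i).
have base i : \sum_v (gdist (inl i : corona G H) v)%:R * f v = p i + S.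
  rewrite sum_corona -big_split; apply: eq_bigr => j _ /=.
  rewrite gdist_corona //= /weight inner_const1_copy mulrDr -addrA.
  congr (_ + _).
  under eq_bigr do rewrite gdist_corona //=.
  by rewrite -mulr_sumr -addn1 natrD; ring.
have leaf i x : \sum_v (gdist (inr (i, x) : corona G H) v)%:R * f v =
    p i + S - (2 * f (inr (i, x)) + \sum_y (adj x y)%:R * f (inr (i, y))).
  (* The bare [weight j] comes from the step leaving the leaf [(i, x)]; its sum over [j]
     vanishes. *)
  transitivity (\sum_j ((gdist i j)%:R * weight j + inner (const_mx 1) (copy j)
      + weight j - (if i == j then (2 * f (inr (i, x)) +
         \sum_y (adj x y)%:R * f (inr (i, y))) else 0))); last first.
    rewrite sumrB 2!big_split /= w0 addr0 -big_mkcond /=.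
    by under [X in _ - X]eq_bigl do rewrite eq_sym; rewrite big_pred1_eq.
  rewrite sum_corona; apply: eq_bigr => j _.
  rewrite /weight inner_const1_copy.
  under eq_bigr do rewrite gdist_corona_copies mulrBl.
  rewrite sumrB -mulr_sumr gdist_corona //= -addn1 natrD.
  have -> : \sum_y (if i == j then 2 * (x == y)%:R + (adj x y)%:R else 0) *
                  f (inr (j, y)) =
      if i == j then 2 * f (inr (i, x)) +
                     \sum_y (adj x y)%:R * f (inr (i, y)) else 0.
    case: eqP => [<-|_]; last by rewrite big1 // => y _; rewrite mul0r.
    under eq_bigr do rewrite mulrDl.
    rewrite big_split /= (bigD1 x) //= eqxx mulr1 big1 ?addr0 // => y.
    by rewrite eq_sym => /negbTE->; rewrite mulr0 mul0r.
  by set a := \sum_x f _; set b := (if _ then _ else _); ring.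
rewrite sum_corona -sumrB.
(* The added [S * weight i] sums to zero. *)
transitivity (\sum_i (weight i * p i - (2 * inner (copy i) (copy i) +
   inner (copy i) (adjacency_mx R H *m copy i)) + S * weight i)); last first.
  by rewrite big_split /= -mulr_sumr w0 mulr0 addr0.
apply: eq_bigr => i _; rewrite base.
under eq_bigr do rewrite leaf.
rewrite adjacency_vec !inner_vec.
under eq_bigr do rewrite mulrBr [X in _ - X]mulrDr.
rewrite sumrB big_split /= -mulr_suml -inner_const1_copy.
rewrite (_ : \sum_x f (inr (i, x)) * (2 * f (inr (i, x))) =
   2 * \sum_x f (inr (i, x)) * f (inr (i, x))); last first.
  by rewrite mulr_sumr; apply: eq_bigr => x _; rewrite mulrCA.
by rewrite /weight; ring.
Qed.

End Corona.

(* [g b / (g + b) t^2] is the minimum over [s] of [g (t - s)^2 + b s^2]. *)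
Lemma parallel_sum_le (R : realType) (g b s t : R) :
  0 < g + b -> g * b / (g + b) * t ^+ 2 <= g * (t - s) ^+ 2 + b * s ^+ 2.
Proof.
move=> gb; rewrite -subr_ge0.
have -> : g * (t - s) ^+ 2 + b * s ^+ 2 - g * b / (g + b) * t ^+ 2 =
    (g + b) * (s - g / (g + b) * t) ^+ 2.
  by field; rewrite gt_eqF.
by rewrite mulr_ge0 ?sqr_ge0 // ltW.
Qed.

(** * The QEC of the corona *)

Theorem theorem6 (R : realType) (G H : sgraph) (kappa n : nat)
    (G_connected : connected_graph G) (G_ge2 : (2 <= #|G|)%N)
    (H_card : #|H| = n) (n_ge1 : (1 <= n)%N)
    (H_regular : regular_graph H kappa) :
  let gamma3 : R := - 2 - set_min (ev (adjacency_mx R H)) in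
  let num : R := gamma3 ^+ 2 + gamma3 * (kappa%:R + 2) in
  let den : R := gamma3 * (n%:R + 1) + kappa%:R + 2 in
  [\/ [/\ 0 < den, QEC R G <= num / den & gamma3 < 0],
      QEC R G <= 0 /\ 0 < gamma3
    | [/\ 0 < QEC R G, QEC R G <= num / den & 0 < gamma3]] ->
  QEC R (corona G H) = - 2 - set_min (ev (adjacency_mx R H)).
Proof.
move=> gamma3 num den hyp.
set lam := set_min _ in gamma3 num den hyp *.
have k0 : 0 <= kappa%:R :> R by rewrite ler0n.
have n0 : 0 < n%:R :> R by rewrite ltr0n.
(* All three cases reduce to this pair: [0 < gamma3] forces [num] and [den] to be positive, and the
   first case supplies both facts. *)
have [den0 qec_le] : 0 < den /\ QEC R G <= num / den.
  have num_den : 0 < gamma3 -> 0 < num /\ 0 < den.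
    move=> g0; split; first by rewrite addr_gt0 ?exprn_gt0 ?mulr_gt0 //; lra.
    by rewrite /den -addrA addr_gt0 ?mulr_gt0 //; lra.
  case: hyp => [[]|[q0 /num_den[num0 den0]]|[_ ? /num_den[]]] //.
  by split=> //; apply: le_trans q0 (ltW (divr_gt0 num0 den0)).
(* If [lam] equals [kappa], then [den] is [- (kappa + 2) * n], which is not positive. *)
have lam_kappa : lam != kappa%:R.
  apply: contraTneq den0 => lamE; rewrite -leNgt /den /gamma3 lamE.
  have := mulr_ge0 k0 (ltW n0); lra.
have [v [v1 v0 vlam]] :=
  min_eigenvector_orthogonal H_card n_ge1 H_regular lam_kappa.
pose b := (kappa%:R - lam) / n%:R.
have gb : gamma3 + b = den / n%:R.
  by rewrite /b /den /gamma3; field; rewrite gt_eqF.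
have gb0 : 0 < gamma3 + b by rewrite gb divr_gt0.
have num_denE : num / den = gamma3 * b / (gamma3 + b).
  rewrite gb /num /b /gamma3; field; rewrite !gt_eqF //.
apply: set_max_eq.
  case/card_gt0P: (ltnW G_ge2) => i0 _.
  (* As [v] sums to zero, all weights vanish and only the block term [- (2 + lam)] survives. *)
  pose f (u : corona G H) : R := match u with
    | inl _ => 0 | inr (i, x) => if i == i0 then v (enum_rank x) 0 else 0 end.
  have copyf i : copy f i = if i == i0 then v else 0.
    case: eqP => [->|/eqP/negbTE i_i0]; apply/matrixP => j k; rewrite !mxE /=.
      by rewrite eqxx enum_valK ord1.
    by rewrite i_i0.
  have inner0 m (u : 'cV[R]_m) : inner u 0 = 0.
    by rewrite -(scale0r 0) innerZr mul0r.
  have weight0 i : weight f i = 0.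
    by rewrite /weight copyf add0r; case: eqP; rewrite ?inner0.
  have sum_weight : \sum_i weight f i = 0 by apply: big1.
  exists (vec f); first split.
  - rewrite inner_corona (bigD1 i0) //= big1 ?addr0 => [|i /negbTE i_i0].
      by rewrite copyf eqxx v1 expr0n add0r.
    by rewrite copyf i_i0 inner0 expr0n addr0.
  - by rewrite inner_corona_const1.
  rewrite corona_form // (_ : vec (weight f) = 0); last first.
    by apply/matrixP => i j; rewrite !mxE weight0.
  rewrite mulmx0 inner0 sub0r (bigD1 i0) //=.
  rewrite big1 ?addr0 => [|i /negbTE i_i0].
    by rewrite copyf eqxx v1 vlam -/lam mulr1 opprD.
  by rewrite copyf i_i0 mulmx0 !inner0 mulr0 addr0.
move=> _ [f [f1 f0] <-].
rewrite (vecE f) in f1 f0 *; move: (fun u => _) f1 f0 => {}f f1 f0.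
rewrite inner_corona_const1 in f0.
(* Restoring the factor [inner (vec f) (vec f) = 1] lets both sides be compared vertex by vertex of
   [G]. *)
suff: inner (vec f) (distance_mx R (corona G H) *m vec f) <=
    gamma3 * inner (vec f) (vec f) by rewrite f1 mulr1.
rewrite corona_form // inner_corona.
set t := weight f in f0 *.
apply: (@le_trans _ _ (\sum_i (num / den * t i ^+ 2) -
    \sum_i (2 * inner (copy f i) (copy f i) +
            inner (copy f i) (adjacency_mx R H *m copy f i)))).
  rewrite lerD2r -mulr_sumr; apply: le_trans (QEC_ge _) _.
    rewrite const_vec inner_vec -[RHS]f0.
    by apply: eq_bigr => i _; rewrite mul1r.
  rewrite inner_vec; under eq_bigr do rewrite -expr2.
  by rewrite ler_wpM2r // sumr_ge0 // => i _; rewrite sqr_ge0.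
rewrite -sumrB mulr_sumr; apply: ler_sum => i _.
have := regular_rayleigh H_card n_ge1 H_regular (copy f i).
rewrite -/lam; set s := inner (const_mx 1) _.
have := parallel_sum_le s (t i) gb0; rewrite -num_denE.
(* Here [t i - s] is the entry of [f] at the base vertex; adding the two inequalities then cancels
   [b * s ^+ 2]. *)
rewrite {2}/t /weight -/s addrK /b => le1 le2.
move: le1 le2; rewrite /gamma3; move: (num / den) (t i) => q ti.
move: (inner (copy f i) (copy f i)) (inner (copy f i) _) => x y le1 le2.
lra.
Qed.
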